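(* Let $S$ be a semigroup with an identity element $1$, let $T$ be a groupoid, and suppose $[S]\cong[T]$. If $T$ is medial, left lateral, or a semigroup, then $S\cong T$.
   Context: A groupoid is a set with a binary operation, written as juxtaposition. A groupoid is medial if $(xy)(zw)=(xz)(yw)$ for all $x,y,z,w$, and left lateral if $x(yz)=y(xz)$ for all $x,y,z$. For a groupoid $S$, $[S]$ denotes the set $S$ with its natural ternary operation $[abc]=(ab)c$. $[S]\cong[T]$ means that there is a bijection $\delta:S\to T$ with $\delta[abc]=[(\delta a)(\delta b)(\delta c)]$ for all $a,b,c\in S$. *)

(* Defs.v *)
From mathcomp Require Import ssreflect ssrfun monoid.

Set Implicit Arguments.
Unset Strict Implicit.
Unset Printing Implicit Defensive.

Local Open Scope group_scope.

(* A groupoid, in the sense of a set with one binary operation, is a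
   [magmaType]. The base class [Magma] carries no choice or decidable-equality
   structure, whereas [semigroupType] and [monoidType] do; associativity and
   the identity laws are therefore stated as properties of a [magmaType]. *)

Definition semigroup (G : magmaType) : Prop := associative ( *%g : G -> G -> G).

Definition identity_element (G : magmaType) (e : G) : Prop :=
  left_id e *%g /\ right_id e *%g.

Definition medial (G : magmaType) : Prop :=
  forall x y z w : G, (x * y) * (z * w) = (x * z) * (y * w).

Definition left_lateral (G : magmaType) : Prop :=
  forall x y z : G, x * (y * z) = y * (x * z).

Definition ternary (G : magmaType) (a b c : G) : G := (a * b) * c.

Definition ternary_isomorphic (S T : magmaType) : Prop :=
  exists2 d : S -> T, bijective d &
    forall a b c : S, d (ternary a b c) = ternary (d a) (d b) (d c).

Definition isomorphic (S T : magmaType) : Prop :=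
  exists2 f : S -> T, bijective f & {morph f : x y / x * y}.

(* Main.v *)
(** Transported to [S] along the bijection [d], the operation of [T] is
    [b, c |-> u b c], where [u] corresponds to [d 1 * d 1] and satisfies
    [u u = 1]. Each of the three laws on [T] forces [u] to be central, and then
    [x |-> d (u x)] is an isomorphism. *)

Require Import Defs.
From mathcomp Require Import ssreflect ssrfun monoid.

Local Open Scope group_scope.

(** As [ternary one one b = b], the element [d one * d one] is a left identity of [T]; prefixing it
    to [d b * d c] gives a ternary product, which [d] respects. *)
Lemma ternary_morphism_twist {S : magmaType} {one : S} {T : magmaType} {d : S -> T} :
  semigroup S -> identity_element one -> bijective d ->
  (forall a b c : S, d (ternary a b c) = ternary (d a) (d b) (d c)) ->
  exists2 u : S, u * u = one & forall b c : S, d b * d c = d (u * b * c).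
Proof.
move=> mulA [mul1 mulr1] [g dK gK] dT.
pose u := g (d one * d one).
have du : d u = d one * d one by rewrite gK.
have ul b : d u * d b = d b by rewrite du -[LHS]dT /ternary !mul1.
have dM b c : d b * d c = d (u * b * c) by rewrite [RHS]dT /ternary ul.
exists u => //; apply: (can_inj dK).
by have := ul one; rewrite dM mulr1.
Qed.

Lemma twist_central {S : magmaType} {one : S} {T : magmaType} {d : S -> T} {u : S} :
  semigroup S -> identity_element one -> injective d -> u * u = one ->
  (forall b c : S, d b * d c = d (u * b * c)) ->
  medial T \/ left_lateral T \/ semigroup T ->
  forall x : S, u * x = x * u.
Proof.
move=> mulA [mul1 mulr1] d_inj uu dM lawT x.
have uK y : u * (u * y) = y by rewrite mulA uu mul1.
case: lawT => [medT | [latT | assocT]].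
(* The two sides of this instance are [d (u * x)] and [d (x * u)]. *)
- have := medT (d one) (d one) (d x) (d one).
  by rewrite !dM => /d_inj; rewrite -!mulA !mulr1 !mul1 !uK.
(* Here, and in the associative case, the instance reduces to [u * (x * u) = x]; multiplying by [u]
   on the left gives the claim. *)
- have := latT (d x) (d one) (d one).
  rewrite !dM => /d_inj; rewrite -!mulA !mulr1 !mul1 !uK => uxu.
  by rewrite -[in LHS]uxu uK.
- have := assocT (d x) (d one) (d one).
  rewrite !dM => /d_inj; rewrite -!mulA !mulr1 !uK => uxu.
  by rewrite -[in LHS]uxu uK.
Qed.

Theorem theorem7 (S : magmaType) (one : S) (T : magmaType) :
  semigroup S -> identity_element one ->
  ternary_isomorphic S T ->
  medial T \/ left_lateral T \/ semigroup T ->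
  isomorphic S T.
Proof.
move=> mulA one_id [d d_bij dT] lawT.
have [u uu dM] := ternary_morphism_twist mulA one_id d_bij dT.
have uC := twist_central mulA one_id (bij_inj d_bij) uu dM lawT.
have uK : involutive (fun x : S => u * x).
  by move=> x; rewrite mulA uu; apply: one_id.1.
exists (fun x => d (u * x)).
  exact: (bij_comp d_bij (inv_bij uK)).
(* The product of the images is [d (x * u * y)]; centrality moves [u] to the front. *)
by move=> x y; rewrite dM uK !mulA uC.
Qed.
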